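(* Let $g$ be a bilinear form on a finite dimensional $\mathbb{F}_2$-space $V$ with basis $\mathcal{V}$, let $\mathbb{F}$ be a field of characteristic different from $2$, and let $\lambda:\mathcal{V}\to\mathbb{F}^*$ be a map. Then the algebra $\mathfrak{C}(V,g,\lambda)$ over $\mathbb{F}$ is isomorphic to a tensor product (over $\mathbb{F}$) of algebras each of which is one of: $\mathbb{F}\times\mathbb{F}$; a quadratic field extension of $\mathbb{F}$; the algebra of $2\times2$ matrices over $\mathbb{F}$; a division algebra $\frac{(\alpha,\beta)}{\mathbb{F}}$ with $\alpha,\beta\in\mathbb{F}^*$ for which there are no $\gamma,\delta\in\mathbb{F}$ with $\beta+\delta^2\alpha=\gamma^2$.
   Context: For an $\mathbb{F}_2$-space $V$ with addition $\oplus$ and basis $\mathcal{V}$, a bilinear form $g:V\times V\to\mathbb{F}_2$ and $\lambda:\mathcal{V}\to\mathbb{F}^*$, the algebra $\mathfrak{C}(V,g,\lambda)$ is the $\mathbb{F}$-algebra with $\mathbb{F}$-basis the set $V$, identity the zero vector (written $\mathbf{1}$), and bilinear multiplication $vw=(-1)^{g(v,w)}\Lambda(v,w)\,(v\oplus w)$ for $v,w\in V$, where $\Lambda(v,w)=\prod_{b\in\mathcal{V},\ b^*(v)b^*(w)=1}(-1)^{g(b,b)}\lambda(b)$ and $b^*:V\to\mathbb{F}_2$ is the coordinate functional of $b$. $\frac{(\alpha,\beta)}{\mathbb{F}}$, for $\alpha,\beta\in\mathbb{F}^*$, denotes the quaternion algebra over $\mathbb{F}$ generated by $v,w$ with $v^2=\alpha\mathbf{1}$,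 $w^2=\beta\mathbf{1}$, $vw+wv=0$. The empty tensor product is $\mathbb{F}$. *)

(* Defs.v *)
From HB Require Import structures.
From mathcomp Require Import all_boot all_order all_algebra all_field.
From mathcomp Require Import ring.

Set Implicit Arguments.
Unset Strict Implicit.
Unset Printing Implicit Defensive.

Import GRing.Theory.
Local Open Scope ring_scope.

(* Bilinear extension to [{ffun I -> F^o}] of a multiplication table c.       *)
Section MultiplicationTable.
Variables (F : fieldType) (I : finType).
Local Notation fV := {ffun I -> F^o}.
Implicit Types (x y z : fV) (i j : I).

Definition fdelta (i : I) : fV := [ffun j => (j == i)%:R].

Definition table_mul (c : I -> I -> fV) x y : fV :=
  \sum_i \sum_j (x i * y j) *: c i j.

Lemma fdelta_sum x : x = \sum_i x i *: fdelta i.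
Proof.
apply/ffunP=> j; rewrite sum_ffunE (bigD1 j) //= !ffunE eqxx /=.
rewrite big1 => [|i ij]; first by rewrite addr0 [RHS]mulr1.
by rewrite !ffunE eq_sym (negbTE ij) [LHS]mulr0.
Qed.

Variable c : I -> I -> fV.
Local Notation "x ** y" := (table_mul c x y) (at level 40).

Lemma table_mulDl : left_distributive (table_mul c) +%R.
Proof.
move=> x y z; rewrite /table_mul -big_split; apply: eq_bigr => i _ /=.
rewrite -big_split; apply: eq_bigr => j _ /=.
by rewrite ffunE mulrDl scalerDl.
Qed.

Lemma table_mulDr : right_distributive (table_mul c) +%R.
Proof.
move=> x y z; rewrite /table_mul -big_split; apply: eq_bigr => i _ /=.
rewrite -big_split; apply: eq_bigr => j _ /=.
by rewrite ffunE mulrDr scalerDl.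
Qed.

Lemma table_mulZl a x y : a *: (x ** y) = (a *: x) ** y.
Proof.
rewrite /table_mul scaler_sumr; apply: eq_bigr => i _.
rewrite scaler_sumr; apply: eq_bigr => j _.
by rewrite scalerA ffunE mulrA.
Qed.

Lemma table_mulZr a x y : a *: (x ** y) = x ** (a *: y).
Proof.
rewrite /table_mul scaler_sumr; apply: eq_bigr => i _.
rewrite scaler_sumr; apply: eq_bigr => j _.
by rewrite scalerA ffunE [in RHS]mulrCA.
Qed.

Lemma table_mul0l y : 0 ** y = 0.
Proof.
rewrite /table_mul big1 // => i _; rewrite big1 // => j _.
by rewrite ffunE mul0r scale0r.
Qed.

Lemma table_mul0r x : x ** 0 = 0.
Proof.
rewrite /table_mul big1 // => i _; rewrite big1 // => j _.
by rewrite ffunE mulr0 scale0r.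
Qed.

Lemma table_mul_suml J (r : seq J) (P : pred J) (f : J -> fV) y :
  (\sum_(k <- r | P k) f k) ** y = \sum_(k <- r | P k) f k ** y.
Proof.
by elim/big_rec2: _ => [|k u v _ <-]; rewrite ?table_mul0l ?table_mulDl.
Qed.

Lemma table_mul_sumr J (r : seq J) (P : pred J) (f : J -> fV) x :
  x ** (\sum_(k <- r | P k) f k) = \sum_(k <- r | P k) x ** f k.
Proof.
by elim/big_rec2: _ => [|k u v _ <-]; rewrite ?table_mul0r ?table_mulDr.
Qed.

Lemma table_mul_delta i j : fdelta i ** fdelta j = c i j.
Proof.
rewrite /table_mul (bigD1 i) //= [X in _ + X]big1 => [|k ki]; last first.
  by rewrite big1 // => l _; rewrite ffunE (negbTE ki) mul0r scale0r.
rewrite addr0 (bigD1 j) //= [X in _ + X]big1 => [|k kj]; last first.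
  by rewrite [fdelta j k]ffunE (negbTE kj) mulr0 scale0r.
by rewrite !ffunE !eqxx mulr1 scale1r addr0.
Qed.

Lemma table_mulA :
  (forall i j k, fdelta i ** (fdelta j ** fdelta k)
                 = (fdelta i ** fdelta j) ** fdelta k) ->
  associative (table_mul c).
Proof.
move=> cA x y z.
rewrite [x]fdelta_sum (table_mul_suml _ _ _ (y ** z)).
rewrite (table_mul_suml _ _ _ y) (table_mul_suml _ _ _ z).
apply: eq_bigr => i _; rewrite -!table_mulZl; congr (_ *: _).
rewrite [y]fdelta_sum (table_mul_suml _ _ _ z) !(table_mul_sumr _ _ _ (_ i)).
rewrite (table_mul_suml _ _ _ z); apply: eq_bigr => j _.
rewrite -!(table_mulZl, table_mulZr); congr (_ *: _).
rewrite [z]fdelta_sum (table_mul_sumr _ _ _ (fdelta j)).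
rewrite !(table_mul_sumr _ _ _ (fdelta i)) (table_mul_sumr _ _ _ (_ ** _)).
by apply: eq_bigr => k _; rewrite -!table_mulZr cA.
Qed.

Lemma table_mul1l (u : fV) :
  (forall i, u ** fdelta i = fdelta i) -> left_id u (table_mul c).
Proof.
move=> u1 x; rewrite [in LHS](fdelta_sum x) table_mul_sumr [RHS]fdelta_sum.
by apply: eq_bigr => i _; rewrite -table_mulZr u1.
Qed.

Lemma table_mul1r (u : fV) :
  (forall i, fdelta i ** u = fdelta i) -> right_id u (table_mul c).
Proof.
move=> u1 x; rewrite [in LHS](fdelta_sum x) table_mul_suml [RHS]fdelta_sum.
by apply: eq_bigr => i _; rewrite -table_mulZl u1.
Qed.

End MultiplicationTable.

(* The algebra C(V, g, lambda), as coordinate vectors on the F-basis V; the    *)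
(* value of lambda at the i-th basis vector b`_i of V is lam i. It is an      *)
(* associative algebra without any assumption on b and lam.                   *)
Definition Calg (F : fieldType) (V : vectType 'F_2) (n : nat) (b : n.-tuple V)
    (g : {biscalar V}) (lam : 'I_n -> F) : Type :=
  {ffun finvect_type V -> F^o}.

Section CAlgebra.
Variables (F : fieldType) (V : vectType 'F_2) (n : nat).
Variables (b : n.-tuple V) (g : {biscalar V}) (lam : 'I_n -> F).

(* (-1)^e: the exponent is the representative of e in {0, 1}. *)
Definition sgn2 (e : 'F_2) : F := (-1) ^+ (e : nat).

Definition Lam (v w : V) : F :=
  \prod_(i < n | coord b i v * coord b i w == 1) (sgn2 (g b`_i b`_i) * lam i).

Local Notation Calg := (Calg b g lam).

Definition Cbasis (v : V) : Calg := fdelta F (v : finvect_type V).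

Definition Cmul : Calg -> Calg -> Calg :=
  table_mul (fun v w : finvect_type V =>
               (sgn2 (g v w) * Lam v w) *: fdelta F (v + w)).

Lemma F2P (e : 'F_2) : e = 0 \/ e = 1.
Proof. by case: e => [[|[|k]] // Hk]; [left|right]; apply/val_inj. Qed.

Lemma sgn2D : {morph sgn2 : d e / d + e >-> d * e}.
Proof.
move=> d e; rewrite /sgn2.
by case: (F2P d) => ->; case: (F2P e) => ->;
   rewrite ?(mul1r, mulr1, expr0, expr1, mulrNN).
Qed.

Lemma Lam_cocycle u v w : Lam u v * Lam (u + v) w = Lam v w * Lam u (v + w).
Proof.
rewrite /Lam 4!(big_mkcond (fun i => coord b i _ * _ == 1)) -!big_split /=.
apply: eq_bigr => i _; rewrite !linearD /=.
set k := _ * lam i.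
by case: (F2P (coord b i u)) => ->; case: (F2P (coord b i v)) => ->;
  case: (F2P (coord b i w)) => ->; rewrite /= ?(mul1r, mulr1).
Qed.

Lemma Lam0l v : Lam 0 v = 1.
Proof. by rewrite /Lam big_pred0 // => i; rewrite linear0 mul0r. Qed.

Lemma Lam0r v : Lam v 0 = 1.
Proof. by rewrite /Lam big_pred0 // => i; rewrite linear0 mulr0. Qed.

Lemma CmulA : associative Cmul.
Proof.
apply: table_mulA => u v w.
rewrite !table_mul_delta -table_mulZl -table_mulZr !table_mul_delta !scalerA.
rewrite addrA; congr (_ *: _).
have -> : g u (v + w : finvect_type V) = g u v + g u w by exact: linearDr.
have -> : g (u + v : finvect_type V) w = g u w + g v w by exact: linearDl.
rewrite !sgn2D.
transitivity (sgn2 (g u v) * sgn2 (g u w) * sgn2 (g v w)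
              * (Lam v w * Lam u (v + w : V))); first by rewrite /=; ring.
by rewrite -Lam_cocycle /=; ring.
Qed.

Lemma Cmul1l : left_id (Cbasis 0) Cmul.
Proof.
apply: table_mul1l => v; rewrite table_mul_delta Lam0l.
by rewrite linear0l /sgn2 expr0 mulr1 scale1r add0r.
Qed.

Lemma Cmul1r : right_id (Cbasis 0) Cmul.
Proof.
apply: table_mul1r => v; rewrite table_mul_delta Lam0r.
by rewrite linear0r /sgn2 expr0 mulr1 scale1r addr0.
Qed.

Lemma Cone_neq0 : Cbasis 0 != 0.
Proof.
by apply/eqP=> /ffunP/(_ 0)/eqP; rewrite !ffunE eqxx oner_eq0.
Qed.

HB.instance Definition _ := Vector.on Calg.
HB.instance Definition _ := GRing.Zmodule_isNzRing.Build Calg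
  CmulA Cmul1l Cmul1r (@table_mulDl _ _ _) (@table_mulDr _ _ _) Cone_neq0.
HB.instance Definition _ := GRing.Lmodule_isLalgebra.Build F Calg
  (@table_mulZl _ _ _).
HB.instance Definition _ := GRing.Lalgebra_isAlgebra.Build F Calg
  (@table_mulZr _ _ _).
HB.instance Definition _ := Algebra_isFalgebra.Build F Calg.

Lemma Cbasis0 : Cbasis 0 = 1. Proof. by []. Qed.

Lemma CbasisM v w :
  Cbasis v * Cbasis w = (sgn2 (g v w) * Lam v w) *: Cbasis (v + w).
Proof. exact: table_mul_delta. Qed.

Lemma Cbasis_sum (x : Calg) : x = \sum_(v : finvect_type V) x v *: Cbasis v.
Proof. exact: fdelta_sum. Qed.

End CAlgebra.

(* The tensor product of two finite dimensional algebras, in coordinates: the *)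
(* basis vector (i, j) stands for e_i (x) f_j, where e and f are the library  *)
(* bases of A and B. Lemma [tensor_universal] is the universal property.      *)
Definition tensor (F : fieldType) (A B : falgType F) : Type :=
  {ffun 'I_(\dim {:A}) * 'I_(\dim {:B}) -> F^o}.

Section Tensor.
Variables (F : fieldType) (A B : falgType F).
Local Notation T := (tensor A B).
Local Notation e := (vbasis {:A}).
Local Notation f := (vbasis {:B}).
Implicit Types (u v : A) (w z : B).

Definition pure u w : T := [ffun p => coord e p.1 u * coord f p.2 w].

Definition tensor_mul : T -> T -> T :=
  table_mul (fun p q : 'I_(\dim {:A}) * 'I_(\dim {:B}) =>
               pure (e`_p.1 * e`_q.1) (f`_p.2 * f`_q.2)).

Lemma pureDl u v w :
  pure (u + v) w = pure u w + pure v w :> {ffun _ -> F^o}.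
Proof. by apply/ffunP=> p; rewrite !ffunE linearD mulrDl. Qed.

Lemma pureDr u w z :
  pure u (w + z) = pure u w + pure u z :> {ffun _ -> F^o}.
Proof. by apply/ffunP=> p; rewrite !ffunE linearD mulrDr. Qed.

Lemma pureZl a u w : pure (a *: u) w = a *: pure u w :> {ffun _ -> F^o}.
Proof. by apply/ffunP=> p; rewrite !ffunE linearZ -mulrA. Qed.

Lemma pureZr a u w : pure u (a *: w) = a *: pure u w :> {ffun _ -> F^o}.
Proof. by apply/ffunP=> p; rewrite !ffunE linearZ /= mulrCA. Qed.

Lemma pure0l w : pure 0 w = 0 :> {ffun _ -> F^o}.
Proof. by apply/ffunP=> p; rewrite !ffunE linear0 mul0r. Qed.

Lemma pure0r u : pure u 0 = 0 :> {ffun _ -> F^o}.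
Proof. by apply/ffunP=> p; rewrite !ffunE linear0 mulr0. Qed.

Lemma pure_suml J (r : seq J) (P : pred J) (h : J -> A) w :
  pure (\sum_(k <- r | P k) h k) w
  = \sum_(k <- r | P k) (pure (h k) w : {ffun _ -> F^o}).
Proof.
by elim/big_rec2: _ => [|k x y _ <-]; rewrite ?pure0l ?pureDl.
Qed.

Lemma pure_sumr J (r : seq J) (P : pred J) (h : J -> B) u :
  pure u (\sum_(k <- r | P k) h k)
  = \sum_(k <- r | P k) (pure u (h k) : {ffun _ -> F^o}).
Proof.
by elim/big_rec2: _ => [|k x y _ <-]; rewrite ?pure0r ?pureDr.
Qed.

Lemma pure_basis (i : 'I_(\dim {:A})) (j : 'I_(\dim {:B})) :
  pure e`_i f`_j = fdelta F (i, j).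
Proof.
apply/ffunP=> -[k l]; rewrite !ffunE /= !coord_free ?(basis_free (vbasisP _)) //.
by rewrite xpair_eqE -natrM mulnb ![_ == k]eq_sym (eq_sym l).
Qed.

Lemma tensor_mul_pure u v w z :
  tensor_mul (pure u w) (pure v z) = pure (u * v) (w * z).
Proof.
rewrite /tensor_mul (coord_vbasis (memvf u)) mulr_suml !pure_suml.
rewrite (table_mul_suml _ _ _ _ (pure _ _)); apply: eq_bigr => i _.
rewrite -scalerAl !pureZl -table_mulZl; congr (_ *: _).
rewrite (coord_vbasis (memvf w)) mulr_suml !pure_sumr.
rewrite (table_mul_suml _ _ _ _ (pure _ _)); apply: eq_bigr => j _.
rewrite -scalerAl !pureZr -table_mulZl; congr (_ *: _).
rewrite (coord_vbasis (memvf v)) mulr_sumr !pure_suml.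
rewrite (table_mul_sumr _ _ _ _ (pure _ _)); apply: eq_bigr => k _.
rewrite -scalerAr !pureZl -table_mulZr; congr (_ *: _).
rewrite (coord_vbasis (memvf z)) mulr_sumr !pure_sumr.
rewrite (table_mul_sumr _ _ _ _ (pure _ _)); apply: eq_bigr => l _.
rewrite -scalerAr !pureZr -table_mulZr; congr (_ *: _).
by rewrite !pure_basis table_mul_delta.
Qed.

Lemma tensor_mulA : associative tensor_mul.
Proof.
apply: table_mulA => -[i i'] [j j'] [k k'].
by rewrite -!pure_basis -/tensor_mul !tensor_mul_pure !mulrA.
Qed.

Lemma tensor_mul1l : left_id (pure 1 1) tensor_mul.
Proof.
apply: table_mul1l => -[i i'].
by rewrite -!pure_basis -/tensor_mul tensor_mul_pure !mul1r.
Qed.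

Lemma tensor_mul1r : right_id (pure 1 1) tensor_mul.
Proof.
apply: table_mul1r => -[i i'].
by rewrite -!pure_basis -/tensor_mul tensor_mul_pure !mulr1.
Qed.

Lemma tensor_one_neq0 : pure 1 1 != 0 :> {ffun _ -> F^o}.
Proof.
have /existsP[i Hi] : [exists i, coord e i 1 != 0].
  apply: contraNT (oner_neq0 A); rewrite negb_exists => /forallP e0.
  rewrite (coord_vbasis (memvf 1)) big1 // => i _.
  by rewrite (eqP (negPn (e0 i))) scale0r.
have /existsP[j Hj] : [exists j, coord f j 1 != 0].
  apply: contraNT (oner_neq0 B); rewrite negb_exists => /forallP e0.
  rewrite (coord_vbasis (memvf 1)) big1 // => j _.
  by rewrite (eqP (negPn (e0 j))) scale0r.
apply/eqP=> /ffunP/(_ (i, j))/eqP; rewrite !ffunE /=.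
by rewrite mulf_eq0 (negbTE Hi) (negbTE Hj).
Qed.

HB.instance Definition _ := Vector.on T.
HB.instance Definition _ := GRing.Zmodule_isNzRing.Build T
  tensor_mulA tensor_mul1l tensor_mul1r
  (@table_mulDl _ _ _) (@table_mulDr _ _ _) tensor_one_neq0.
HB.instance Definition _ := GRing.Lmodule_isLalgebra.Build F T
  (@table_mulZl _ _ _).
HB.instance Definition _ := GRing.Lalgebra_isAlgebra.Build F T
  (@table_mulZr _ _ _).
HB.instance Definition _ := Algebra_isFalgebra.Build F T.

Lemma pure11 : pure 1 1 = 1. Proof. by []. Qed.

Lemma pureM u v w z : pure u w * pure v z = pure (u * v) (w * z).
Proof. exact: tensor_mul_pure. Qed.

Lemma tensor_universal (W : lmodType F) (h : {bilinear A -> B -> W}) :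
  exists2 k : {linear T -> W}, forall u w, k (pure u w) = h u w
    & forall k' : {linear T -> W},
        (forall u w, k' (pure u w) = h u w) -> k' =1 k.
Proof.
pose k (x : T) := \sum_p x p *: h e`_p.1 f`_p.2.
have k_lin : linear k.
  move=> a x y; rewrite /k scaler_sumr -big_split; apply: eq_bigr => p _ /=.
  by rewrite !ffunE scalerDl scalerA.
pose kL : {linear T -> W} := HB.pack k (GRing.isLinear.Build F T W *:%R k k_lin).
exists kL => [u w|k' k'E x] /=.
  rewrite [in RHS](coord_vbasis (memvf u)) [in RHS](coord_vbasis (memvf w)).
  transitivity (\sum_i \sum_j (pure u w) (i, j) *: h e`_i f`_j).
    by rewrite pair_bigA; apply: eq_bigr => -[i j].
  rewrite linear_sumlz; apply: eq_bigr => i _.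
  rewrite linear_sumr; apply: eq_bigr => j _.
  by rewrite linearZl_LR linearZr_LR scalerA ffunE.
rewrite [in LHS](fdelta_sum (x : {ffun _ -> F^o})) (linear_sum k').
by apply: eq_bigr => -[i j] _; rewrite linearZ -pure_basis k'E.
Qed.

End Tensor.

(* The quaternion algebra (al, be) / F generated by quat_i and quat_j; the    *)
(* pair of booleans (r, s) indexes the basis vector quat_i ^ r * quat_j ^ s.  *)
(* Lemma [quat_universal] is the presentation by generators and relations.    *)
Definition quat (F : fieldType) (al be : F) : Type :=
  {ffun bool * bool -> F^o}.

Section Quaternion.
Variables (F : fieldType) (al be : F).
Local Notation Q := (quat al be).
Local Notation delta := (fdelta F).

Definition quat_mul : Q -> Q -> Q :=
  table_mul (fun p q : bool * bool =>
    ((-1) ^+ (p.2 && q.1) * al ^+ (p.1 && q.1) * be ^+ (p.2 && q.2))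
      *: delta (p.1 (+) q.1, p.2 (+) q.2)).

Definition quat_i : Q := delta (true, false).
Definition quat_j : Q := delta (false, true).

Lemma quat_mulA : associative quat_mul.
Proof.
apply: table_mulA => -[a b] [c d] [e f].
rewrite !table_mul_delta -table_mulZl -table_mulZr !table_mul_delta !scalerA.
rewrite /= !addbA; congr (_ *: _).
by case: a; case: b; case: c; case: d; case: e; case: f;
  rewrite /= ?(expr0, expr1); ring.
Qed.

Lemma quat_mul1l : left_id (delta (false, false)) quat_mul.
Proof.
apply: table_mul1l => -[a b]; rewrite table_mul_delta /= !expr0.
by rewrite !mulr1 scale1r.
Qed.

Lemma quat_mul1r : right_id (delta (false, false)) quat_mul.
Proof.
apply: table_mul1r => -[a b]; rewrite table_mul_delta /= !andbF !expr0.
by rewrite !mulr1 scale1r !addbF.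
Qed.

Lemma quat_one_neq0 : delta (false, false) != 0.
Proof. by apply/eqP=> /ffunP/(_ (false, false))/eqP; rewrite !ffunE oner_eq0. Qed.

HB.instance Definition _ := Vector.on Q.
HB.instance Definition _ := GRing.Zmodule_isNzRing.Build Q
  quat_mulA quat_mul1l quat_mul1r
  (@table_mulDl _ _ _) (@table_mulDr _ _ _) quat_one_neq0.
HB.instance Definition _ := GRing.Lmodule_isLalgebra.Build F Q
  (@table_mulZl _ _ _).
HB.instance Definition _ := GRing.Lalgebra_isAlgebra.Build F Q
  (@table_mulZr _ _ _).
HB.instance Definition _ := Algebra_isFalgebra.Build F Q.

Lemma quat_deltaM p q :
  (delta p : Q) * (delta q : Q)
  = ((-1) ^+ (p.2 && q.1) * al ^+ (p.1 && q.1) * be ^+ (p.2 && q.2))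
      *: (delta (p.1 (+) q.1, p.2 (+) q.2) : Q).
Proof. exact: table_mul_delta. Qed.

Lemma quat_delta1 : delta (false, false) = 1 :> Q. Proof. by []. Qed.

Lemma quat_ii : quat_i * quat_i = al%:A.
Proof. by rewrite quat_deltaM /= !expr0 expr1 mul1r mulr1. Qed.

Lemma quat_jj : quat_j * quat_j = be%:A.
Proof. by rewrite quat_deltaM /= !expr0 expr1 !mul1r. Qed.

Lemma quat_ij : quat_i * quat_j = delta (true, true).
Proof. by rewrite quat_deltaM /= !expr0 !mul1r scale1r. Qed.

Lemma quat_ij_ji : quat_i * quat_j + quat_j * quat_i = 0.
Proof.
by rewrite !quat_deltaM /= !expr0 expr1 !mulr1 scale1r scaleN1r subrr.
Qed.

Lemma quat_sum (x : Q) :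
  x = x (false, false) *: 1 + x (true, false) *: quat_i
      + x (false, true) *: quat_j + x (true, true) *: (quat_i * quat_j).
Proof.
rewrite quat_ij {1}[x]fdelta_sum.
transitivity (\sum_r \sum_s x (r, s) *: (delta (r, s) : Q)).
  by rewrite pair_bigA; apply: eq_bigr => -[].
rewrite !big_bool /= -addrA [RHS]addrC; congr (_ + _).
by rewrite addrA addrAC (addrC (_ *: _)).
Qed.

Lemma quat_universal (B : algType F) (v w : B) :
    v * v = al%:A -> w * w = be%:A -> v * w + w * v = 0 ->
  exists2 k : {lrmorphism Q -> B}, k quat_i = v /\ k quat_j = w
    & forall k' : {lrmorphism Q -> B},
        k' quat_i = v /\ k' quat_j = w -> k' =1 k.
Proof.
move=> vv ww vw.
pose m (p : bool * bool) : B := v ^+ p.1 * w ^+ p.2.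
pose k (x : Q) : B := \sum_p x p *: m p.
have k_lin : linear k.
  move=> a x y; rewrite /k scaler_sumr -big_split; apply: eq_bigr => p _ /=.
  by rewrite !ffunE scalerDl scalerA.
have kd p : k (delta p) = m p.
  rewrite /k (bigD1 p) //= big1 => [|q qp]; last first.
    by rewrite ffunE (negbTE qp) scale0r.
  by rewrite ffunE eqxx scale1r addr0.
pose kL : {linear Q -> B} :=
  HB.pack k (GRing.isLinear.Build F Q B *:%R k k_lin).
have kZ a (x : Q) : k (a *: x) = a *: k x by exact: (linearZ_LR kL).
have ksum J (r : seq J) (h : J -> Q) :
    k (\sum_(i <- r) h i) = \sum_(i <- r) k (h i).
  exact: (linear_sum kL).
have wv : w * v = - (v * w) by apply/eqP; rewrite -addr_eq0 addrC vw.
have wvr (x : B) : w * (v * x) = - (v * (w * x)).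
  by rewrite !mulrA wv mulNr.
have vvr (x : B) : v * (v * x) = al *: x by rewrite mulrA vv mulr_algl.
have wwr (x : B) : w * (w * x) = be *: x by rewrite mulrA ww mulr_algl.
have mM p q : m p * m q
    = ((-1) ^+ (p.2 && q.1) * al ^+ (p.1 && q.1) * be ^+ (p.2 && q.2))
      *: m (p.1 (+) q.1, p.2 (+) q.2).
  by case: p q => [[] []] [[] []]; rewrite /m /= ?(expr0, expr1) -?mulrA
    ?(mul1r, mulr1, wvr, wv, vvr, wwr, vv, ww, mulrN, mulN1r);
    rewrite -?scalerAr
    ?(mulr1, scalerA, scalerN, scaleNr, mulrN, mulN1r, scale1r, mul1r).
have kM : monoid_morphism kL.
  split; first by rewrite -quat_delta1 [LHS]kd /m mul1r.
  have kMd p q : k ((delta p : Q) * (delta q : Q)) = k (delta p) * k (delta q).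
    by rewrite quat_deltaM kZ /= !kd mM.
  have kMl p (y : Q) : k ((delta p : Q) * y) = k (delta p) * k y.
    rewrite [y]fdelta_sum [(delta p : Q) * _]table_mul_sumr !ksum.
    rewrite mulr_sumr; apply: eq_bigr => q _.
    by rewrite -table_mulZr !kZ -scalerAr -kMd.
  move=> x y; rewrite /= [x]fdelta_sum [_ * y]table_mul_suml !ksum.
  rewrite mulr_suml; apply: eq_bigr => p _.
  by rewrite -table_mulZl !kZ -scalerAl -kMl.
pose kA : {lrmorphism Q -> B} :=
  HB.pack k (GRing.isLinear.Build F Q B *:%R k k_lin)
            (GRing.isMonoidMorphism.Build Q B k kM).
exists kA => [|k' [k'i k'j] x].
  by split; rewrite [LHS]kd /m /= ?mul1r ?mulr1.
have kE (l : {lrmorphism Q -> B}) : l quat_i = v /\ l quat_j = w ->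
    l x = x (false, false) *: 1 + x (true, false) *: v
          + x (false, true) *: w + x (true, true) *: (v * w).
  move=> [li lj].
  have lij : l (quat_i * quat_j) = v * w by rewrite -li -lj; exact: rmorphM.
  rewrite [in LHS](quat_sum x) !linearD !linearZ /=.
  by rewrite rmorph1 lij li lj.
rewrite !kE //; split; by rewrite [LHS]kd /m /= ?mul1r ?mulr1.
Qed.

End Quaternion.

HB.instance Definition _ (F : fieldType) :=
  GRing.UnitAlgebra.on (F^o * F^o)%type.

Definition alg_iso (F : fieldType) (A B : algType F) : Prop :=
  exists h : {lrmorphism A -> B}, bijective h.

Definition division_alg (F : fieldType) (A : falgType F) : Prop :=
  forall x : A, x != 0 -> x \is a GRing.unit.

(* The unit F^o ends the iterated product, so that the empty product is F. *)
Definition tensor_all (F : fieldType) (s : seq (falgType F)) : falgType F :=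
  foldr (fun A B : falgType F => tensor A B : falgType F) (F^o : falgType F) s.

Inductive C_factor (F : fieldType) : falgType F -> Prop :=
| Split_factor : C_factor (F^o * F^o)%type
| Quadratic_factor (L : fieldExtType F) of \dim {:L} = 2%N : C_factor L
| Matrix_factor : C_factor 'M[F]_2
| Quaternion_factor (al be : F) of al != 0 & be != 0
    & division_alg (quat al be)
    & (~ exists ga de : F, be + de ^+ 2 * al = ga ^+ 2) :
    C_factor (quat al be).

(* Main.v *)
From HB Require Import structures.
From Stdlib Require Import Classical_Prop.
Require Import Defs.
From mathcomp Require Import all_boot all_order all_algebra all_field.
From mathcomp Require Import ring.
Import GRing.Theory.
Local Open Scope ring_scope.

Set Implicit Arguments.
Unset Strict Implicit.
Unset Printing Implicit Defensive.

(** In C(V, g, lam) the basis vectors multiply up to nonzero scalars like the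
    vectors of V add; each squares to a nonzero scalar, and two of them commute
    or anticommute according to the alternating form g(v, w) + g(w, v). So the
    decomposition of V for this form into hyperbolic planes and lines of the
    radical is a decomposition of the algebra into commuting pieces: a line <v>
    with v^2 = a gives F[x]/(x^2 - a), and a plane <v, w> with v^2 = al,
    w^2 = be and vw = -wv gives the quaternion algebra (al, be).

    The pieces are identified separately. If a = c^2, then F x F is generated by
    (c, -c), which plays the part of x; otherwise x^2 - a is irreducible
    ([quadratic_factor]). If be is a norm from F(sqrt al), that is
    be + de^2 al = ga^2, then (al, be) is the matrix algebra, by explicit
    matrices ([quat_split]); otherwise the norm form of (al, be) is anisotropic,
    so that conjugation gives inverses ([quat_division]).

    To assemble them, an algebra A is said to generate a subspace U of V if it
    maps to C(V, g, lam) so that all basis vectors from U are hit, the image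
    commutes with whatever commutes with these basis vectors, and dim A =
    2^(dim U) ([generates]). Orthogonal subspaces with trivial intersection
    have commuting images, so the tensor product generates their sum
    ([generates_tensor]); induction on dim U yields a tensor product of factors
    for every U ([generates_all]). For U = V the map is onto between algebras
    of the same dimension, hence an isomorphism ([generates_full_iso]). *)

(** * Algebra morphisms *)

Lemma lrmorphism_of_fun (F : fieldType) (A B : algType F) (k : A -> B) :
    linear k -> k 1 = 1 -> {morph k : x y / x * y} ->
  exists kk : {lrmorphism A -> B}, kk =1 k.
Proof.
move=> klin k1 kM.
pose kL : {linear A -> B} := HB.pack k (GRing.isLinear.Build F A B *:%R k klin).
have km : monoid_morphism kL by split.
by exists (HB.pack k (GRing.isLinear.Build F A B *:%R k klin)
            (GRing.isMonoidMorphism.Build A B k km) : {lrmorphism A -> B}).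
Qed.

Lemma lrmorphism_inv (F : fieldType) (A B : algType F)
    (k : {lrmorphism A -> B}) :
  bijective k -> exists2 k' : {lrmorphism B -> A}, cancel k k' & cancel k' k.
Proof.
case=> f kf fk.
have [||x y|k' k'E] := @lrmorphism_of_fun F B A f.
- by move=> c x y; apply: (can_inj kf); rewrite linearP /= !fk.
- by rewrite -(rmorph1 k) kf.
- by apply: (can_inj kf); rewrite rmorphM /= !fk.
by exists k' => x; rewrite k'E.
Qed.

Lemma onto_bijective (F : fieldType) (A B : falgType F) (k : {linear A -> B}) :
    \dim {:A} = \dim {:B} -> (forall y, exists x, k x = y) -> bijective k.
Proof.
move=> dAB k_onto; pose f := linfun k.
have fE x : f x = k x by rewrite lfunE.
have f_full : limg f = fullv.
  apply/vspaceP=> y; rewrite memvf; have [x <-] := k_onto y.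
  by rewrite -fE memv_img ?memvf.
have kf0 : lker f == 0%VS.
  have := limg_ker_dim f fullv; rewrite f_full dAB capfv => /eqP.
  by rewrite -{2}[\dim {:B}]add0n eqn_add2r dimv_eq0.
exists f^-1%VF => x; first by rewrite -fE lker0_lfunK.
by have [y <-] := k_onto x; rewrite -!fE lker0_lfunK.
Qed.

Lemma injective_bijective (F : fieldType) (A B : falgType F)
    (k : {linear A -> B}) :
  \dim {:A} = \dim {:B} -> (forall x, k x = 0 -> x = 0) -> bijective k.
Proof.
move=> dAB k_inj; apply: onto_bijective => // y; pose f := linfun k.
have fE x : f x = k x by rewrite lfunE.
have kf0 : lker f == 0%VS.
  apply/eqP/vspaceP=> x; rewrite memv_ker memv0 fE.
  apply/eqP/eqP=> [/k_inj//|->].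
  by rewrite linear0.
have f_full : limg f == fullv.
  rewrite eqEdim subvf -dAB -(limg_ker_dim f fullv) (eqP kf0).
  by rewrite capv0 dimv0 add0n leqnn.
have : y \in limg f by rewrite (eqP f_full) memvf.
by case/memv_imgP=> x _ ->; exists x.
Qed.

Lemma dim_ffun_scalar (F : fieldType) (I : finType) :
  dim {ffun I -> F^o} = #|I|.
Proof. exact: muln1. Qed.

(** * Morphisms out of a tensor product *)

Section TensorHom.
Variables (F : fieldType) (A B : falgType F).

Lemma dim_tensor : \dim {:tensor A B} = (\dim {:A} * \dim {:B})%N.
Proof. by rewrite dimvf [LHS]dim_ffun_scalar card_prod !card_ord. Qed.

Lemma tensor_ind (P : tensor A B -> Prop) :
    P 0 -> (forall x y, P x -> P y -> P (x + y)) ->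
    (forall u w, P (pure u w)) -> forall x, P x.
Proof.
move=> P0 PD Ppure x.
rewrite [x](fdelta_sum (x : {ffun _ -> F^o})).
elim/big_ind: _ => // -[i j] _.
by have := Ppure (x (i, j) *: (vbasis {:A})`_i) (vbasis {:B})`_j;
   rewrite /= pureZl pure_basis.
Qed.

(** The linear map given by the universal property is multiplicative because
    h w can be moved past f v. *)
Lemma tensor_hom (C : algType F) (f : {lrmorphism A -> C})
    (h : {lrmorphism B -> C}) :
    (forall u w, f u * h w = h w * f u) ->
  exists k : {lrmorphism tensor A B -> C}, forall u w, k (pure u w) = f u * h w.
Proof.
move=> fhC; pose m u w := f u * h w.
have m_lin : bilinear_for *:%R *:%R m.
  split=> [w a x y | u a x y]; rewrite /m !linearP /=.
    by rewrite mulrDl scalerAl.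
  by rewrite mulrDr scalerAr.
pose mB : {bilinear A -> B -> C} :=
  HB.pack m (bilinear_isBilinear.Build F A B C *:%R *:%R m m_lin).
have [k kE _] := tensor_universal mB.
have kM x y : k (x * y) = k x * k y.
  elim/tensor_ind: x => [|x1 x2 IH1 IH2|u w].
  - by rewrite mul0r linear0 mul0r.
  - by rewrite mulrDl !linearD mulrDl IH1 IH2.
  elim/tensor_ind: y => [|y1 y2 IH1 IH2|v z].
  - by rewrite mulr0 linear0 mulr0.
  - by rewrite mulrDr !linearD mulrDr IH1 IH2.
  rewrite pureM !kE /= /m !rmorphM -!mulrA; congr (_ * _).
  by rewrite !mulrA fhC.
have k1 : k 1 = 1 by rewrite -pure11 kE /= /m !rmorph1 mulr1.
have [kk kkE] := lrmorphism_of_fun (linearP k) k1 kM.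
by exists kk => u w; rewrite kkE kE.
Qed.

End TensorHom.

(** * Classification of quaternion algebras *)

Section QuaternionClassification.
Variable F : fieldType.
Hypothesis F_char : 2%N \notin [pchar F].

Lemma two_neq0 : 2%:R != 0 :> F.
Proof. by move: F_char; rewrite inE /=. Qed.

Lemma dim_quat (al be : F) : \dim {:quat al be} = 4%N.
Proof. by rewrite dimvf [LHS]dim_ffun_scalar card_prod card_bool. Qed.

(** In M_2(F), i is the matrix of multiplication by sqrt al on F(sqrt al), in
    the basis 1, sqrt al; j is multiplication by ga + de sqrt al composed with
    conjugation. The square of j is then the norm of ga + de sqrt al, which is
    be. *)
Lemma quat_split (al be ga de : F) :
    al != 0 -> be != 0 -> be + de ^+ 2 * al = ga ^+ 2 ->
  exists k : {lrmorphism quat al be -> 'M[F]_2}, bijective k.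
Proof.
move=> al0 be0 norm_be.
pose mx (p q r s : F) : 'M[F]_2 :=
  \matrix_(i, j) if i == 0 then if j == 0 then p else q
                 else if j == 0 then r else s.
have mxM p q r s p' q' r' s' : mx p q r s * mx p' q' r' s'
    = mx (p * p' + q * r') (p * q' + q * s')
         (r * p' + s * r') (r * q' + s * s').
  apply/matrixP=> i j; rewrite !mxE !big_ord_recl big_ord0 addr0 !mxE /=.
  by case: ifP; case: ifP.
have mxZ c p q r s : c *: mx p q r s = mx (c * p) (c * q) (c * r) (c * s).
  by apply/matrixP=> i j; rewrite !mxE; case: ifP; case: ifP.
have mxD p q r s p' q' r' s' : mx p q r s + mx p' q' r' s'
    = mx (p + p') (q + q') (r + r') (s + s').
  by apply/matrixP=> i j; rewrite !mxE; case: ifP; case: ifP.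
have mx1 : 1 = mx 1 0 0 1.
  apply/matrixP=> i j; rewrite !mxE.
  by case: i j => [[|[|//]] ?] [[|[|//]] ?].
have mx0 : 0 = mx 0 0 0 0.
  by apply/matrixP=> i j; rewrite !mxE; case: ifP; case: ifP.
have be_norm : be = ga ^+ 2 - de ^+ 2 * al by rewrite -norm_be addrK.
pose I := mx 0 al 1 0; pose J := mx ga (- (al * de)) de (- ga).
have II : I * I = al%:A by rewrite mxM mx1 mxZ; congr (mx _ _ _ _); ring.
have JJ : J * J = be%:A.
  by rewrite mxM mx1 mxZ be_norm; congr (mx _ _ _ _); ring.
have IJ : I * J + J * I = 0.
  by rewrite !mxM mxD mx0; congr (mx _ _ _ _); ring.
have [k [kI kJ] _] := quat_universal II JJ IJ.
exists k; apply: injective_bijective => [|x].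
  by rewrite dim_quat dimvf.
move=> kx0; have {kx0} : k x = 0 by [].
rewrite {1}[x]quat_sum !linearD !linearZ rmorph1 rmorphM /= kI kJ.
rewrite mxM mx1 !mxZ !mxD => /matrixP k0.
have := k0 0 0; have := k0 0 1; have := k0 1 0; have := k0 1 1.
rewrite !mxE /= [x in _ -> x = 0]quat_sum.
move: (x (false, false)) (x (true, false)) (x (false, true)) (x (true, true)).
move=> x1 x2 x3 x4.
rewrite !(mulr0, mul0r, mulr1, mul1r, addr0, add0r) => k11 k10 k01 k00.
(* The trace and the antidiagonal isolate x1 and x2; what remains is a system *)
(* in x3 and x4 of determinant ga ^+ 2 - al * de ^+ 2 = be.                   *)
have x1_0 : x1 = 0.
  apply: (mulfI two_neq0); rewrite mulr0.
  by have := congr2 +%R k00 k11; rewrite addr0 => <-; ring.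
have x2_0 : x2 = 0.
  apply: (mulfI (mulf_neq0 two_neq0 al0)); rewrite mulr0.
  by have := congr2 (fun s t => s + al * t) k01 k10;
    rewrite mulr0 addr0 => <-; ring.
move: k00 k10; rewrite x1_0 x2_0 !add0r => k00 k10.
have x3_0 : x3 = 0.
  apply: (mulfI be0); rewrite mulr0.
  have := congr2 (fun s t => ga * s - al * de * t) k00 k10.
  by rewrite !mulr0 subr0 => <-; rewrite be_norm; ring.
have x4_0 : x4 = 0.
  apply: (mulfI be0); rewrite mulr0.
  have := congr2 (fun s t => ga * t - de * s) k00 k10.
  by rewrite !mulr0 subr0 => <-; rewrite be_norm; ring.
by rewrite x3_0 x4_0 !scale0r !addr0.
Qed.

(** The norm form is N(a0 + a1 sqrt al) - be N(a2 + a3 sqrt al), with N the norm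
    of F(sqrt al); a nontrivial zero would write be as a quotient of two values
    of N, hence as a value of N, since N is multiplicative. *)
Lemma quat_norm_anisotropic (al be a0 a1 a2 a3 : F) :
    al != 0 -> ~ (exists ga de : F, be + de ^+ 2 * al = ga ^+ 2) ->
    a0 ^+ 2 - al * a1 ^+ 2 - be * a2 ^+ 2 + al * be * a3 ^+ 2 = 0 ->
  [/\ a0 = 0, a1 = 0, a2 = 0 & a3 = 0].
Proof.
move=> al0 not_norm norm0.
have al_nsq p q : p ^+ 2 - al * q ^+ 2 = 0 -> p = 0 /\ q = 0.
  move=> /eqP; rewrite subr_eq0 => /eqP pq.
  have [q0|q0] := eqVneq q 0.
    split=> //; apply/eqP; move/eqP: pq.
    by rewrite q0 expr0n mulr0 sqrf_eq0.
  case: not_norm; pose c := p / q.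
  have cc : c ^+ 2 = al by rewrite /c expr_div_n pq mulfK ?expf_neq0.
  have c0 : c != 0 by apply: contraNneq al0 => c0; rewrite -cc c0 expr0n.
  (* If al is the square of c, every be factors as (ga - c de) (ga + c de); *)
  (* take the factors 1 and be.                                             *)
  exists ((be + 1) / 2%:R), ((be - 1) / (2%:R * c)); rewrite -cc.
  by field; rewrite two_neq0 c0.
have [n0|n0] := eqVneq (a2 ^+ 2 - al * a3 ^+ 2) 0.
  have [a2_0 a3_0] := al_nsq _ _ n0.
  move: norm0; rewrite a2_0 a3_0 expr0n !mulr0 subr0 addr0.
  by case/al_nsq=> -> ->.
case: not_norm.
exists ((a0 * a2 + al * a1 * a3) / (a2 ^+ 2 - al * a3 ^+ 2)).
exists ((a0 * a3 + a1 * a2) / (a2 ^+ 2 - al * a3 ^+ 2)).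
have be_E : be = (a0 ^+ 2 - al * a1 ^+ 2) / (a2 ^+ 2 - al * a3 ^+ 2).
  apply: (mulIf n0); rewrite divfK //; apply/eqP; rewrite -subr_eq0 -oppr_eq0.
  by rewrite -norm0; apply/eqP; ring.
by rewrite be_E; field.
Qed.

Lemma quat_division (al be : F) :
    al != 0 -> ~ (exists ga de : F, be + de ^+ 2 * al = ga ^+ 2) ->
  division_alg (quat al be).
Proof.
move=> al0 not_norm x x0.
pose el (p q r s : F) : quat al be :=
  [ffun ab => if ab.1 then (if ab.2 then s else q) else if ab.2 then r else p].
pose x0' := x (false, false); pose x1 := x (true, false).
pose x2 := x (false, true); pose x3 := x (true, true).
(* nx is the norm, and the inverse is the conjugate divided by it. *)
pose nx := x0' ^+ 2 - al * x1 ^+ 2 - be * x2 ^+ 2 + al * be * x3 ^+ 2.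
have ext (y z : quat al be) : (forall p, y p = z p) -> y = z.
  by move=> yz; apply/(ffunP (y : {ffun bool * bool -> F^o})).
have sum_bool2 (f : bool * bool -> F) :
    \sum_p f p = f (true, true) + f (true, false)
                 + (f (false, true) + f (false, false)).
  transitivity (\sum_r \sum_s f (r, s)); last by rewrite !big_bool.
  by rewrite pair_bigA; apply: eq_bigr => -[].
have elM p q r s p' q' r' s' : el p q r s * el p' q' r' s'
  = el (p * p' + al * (q * q') + be * (r * r') - al * be * (s * s'))
       (p * q' + q * p' - be * (r * s') + be * (s * r'))
       (p * r' + r * p' + al * (q * s') - al * (s * q'))
       (p * s' + s * p' + q * r' - r * q').
  apply: ext => -[a b].
  transitivity (\sum_u \sum_v el p q r s u * el p' q' r' s' v *
     ((-1) ^+ (u.2 && v.1) * al ^+ (u.1 && v.1) * be ^+ (u.2 && v.2) *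
      ((a, b) == (u.1 (+) v.1, u.2 (+) v.2))%:R)).
    rewrite sum_ffunE; apply: eq_bigr => u _; rewrite sum_ffunE.
    by apply: eq_bigr => v _; rewrite !ffunE.
  rewrite !sum_bool2 !ffunE /=.
  by case: a; case: b; rewrite /= !expr0 !expr1; ring.
have xE : x = el x0' x1 x2 x3 :> quat al be.
  by apply: ext => -[[] []]; rewrite ffunE.
have nx0 : nx != 0.
  apply: contraNneq x0 => /quat_norm_anisotropic[] // x0_0 x1_0 x2_0 x3_0.
  by rewrite xE x0_0 x1_0 x2_0 x3_0; apply/eqP/ext=> -[[] []]; rewrite !ffunE.
have elZ c p q r s : c *: el p q r s = el (c * p) (c * q) (c * r) (c * s).
  by apply: ext => -[[] []]; rewrite !ffunE.
have el1 : 1 = el 1 0 0 0.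
  by rewrite -quat_delta1; apply: ext => -[[] []]; rewrite !ffunE.
apply/unitrP; exists (nx^-1 *: el x0' (- x1) (- x2) (- x3)).
rewrite xE -scalerAl -scalerAr !elM !elZ el1.
move: nx0; rewrite /nx {nx xE}; move: x0' x1 x2 x3 => /= p q r s nx0.
by split; congr (el _ _ _ _); field.
Qed.

End QuaternionClassification.

(** * The algebras generated by a line and by a plane *)

Section Factors.
Variables (F : fieldType) (C : algType F).
Hypothesis F_char : 2%N \notin [pchar F].

(** F[x]/(x^2 - a) is represented by any two-dimensional algebra with a
    nonscalar square root z of a, so that F x F and quadratic fields are
    treated alike. The element v may be a scalar. *)
Lemma quadratic_hom (L : falgType F) (a : F) (z : L) (v : C) :
    \dim {:L} = 2%N -> z * z = a%:A -> z \notin <[1]>%VS -> v * v = a%:A ->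
  exists2 k : {lrmorphism L -> C}, k z = v
    & forall y, exists p q, k y = p *: 1 + q *: v.
Proof.
move=> dimL zz zF vv; pose X := [tuple 1; z].
have X_free : free X.
  rewrite (perm_free (_ : perm_eq _ [:: z; 1])) ?(perm_catC [:: 1] [:: z]) //.
  by rewrite free_cons span_seq1 zF seq1_free oner_neq0.
have X_basis : basis_of {:L} X.
  by rewrite basisEfree X_free subvf dimL.
pose k (y : L) : C := coord X 0 y *: 1 + coord X 1 y *: v.
have LE y : y = coord X 0 y *: 1 + coord X 1 y *: z.
  rewrite [LHS](coord_basis X_basis (memvf y)) !big_ord_recl big_ord0 addr0 /=.
  by congr (coord X _ y *: _ + coord X _ y *: _); apply/val_inj.
have k_lin : linear k.
  move=> c x y; rewrite /k !(linearP (coord X _)) /=.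
  by rewrite !scalerDl scalerDr !scalerA addrACA.
have kE p q : k (p *: 1 + q *: z) = p *: 1 + q *: v.
  rewrite /k !linearD !linearZ /=.
  have c1 (i : 'I_2) : coord X i 1 = (i == 0)%:R.
    by rewrite eq_sym -(coord_free 0 i X_free).
  have cz (i : 'I_2) : coord X i z = (i == 1)%:R.
    by rewrite eq_sym -(coord_free 1 i X_free).
  by rewrite !c1 !cz /= !mulr1 !mulr0 addr0 add0r.
have prodE (D : algType F) (t : D) p q p' q' : t * t = a%:A ->
    (p *: 1 + q *: t) * (p' *: 1 + q' *: t)
    = (p * p' + q * q' * a) *: 1 + (p * q' + q * p') *: t.
  move=> tt; rewrite mulrDl !mulrDr -!scalerAl -!scalerAr !mul1r !mulr1 tt.
  by rewrite !scalerA !scalerDl addrACA [_ + (_ * _) *: _ + _]addrAC -!addrA;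
     congr (_ + _); rewrite addrCA; congr (_ + _); rewrite addrC.
have k1 : k 1 = 1 by have := kE 1 0; rewrite !scale0r !addr0 !scale1r.
have kM : {morph k : x y / x * y}.
  by move=> x y; rewrite (LE x) (LE y) (prodE L) // !kE (prodE C).
have [kk kkE] := lrmorphism_of_fun k_lin k1 kM.
exists kk => [|y]; last by exists (coord X 0 y), (coord X 1 y); rewrite kkE.
by rewrite kkE; have := kE 0 1; rewrite !scale0r !add0r !scale1r.
Qed.

(** The description of the image serves to determine what commutes with it. *)
Lemma quadratic_factor (a : F) (v : C) : a != 0 -> v * v = a%:A ->
  exists L : falgType F, [/\ C_factor L, \dim {:L} = 2%N
    & exists2 k : {lrmorphism L -> C}, exists z, k z = v
        & forall y, exists p q, k y = p *: 1 + q *: v].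
Proof.
move=> a0 vv.
suff [L [FL dL [z zz zF]]] : exists L : falgType F,
    [/\ C_factor L, \dim {:L} = 2%N
      & exists2 z : L, z * z = a%:A & z \notin <[1]>%VS].
  exists L; split=> //; have [k kz kE] := quadratic_hom dL zz zF vv.
  by exists k => //; exists z.
have [[c ac]|a_nsq] := classic (exists c, a = c ^+ 2).
  exists (F^o * F^o)%type; split; first exact: Split_factor.
    by rewrite dimvf.
  (* c and - c differ, as 2 c <> 0, so that this root of a is not a scalar. *)
  exists (c, - c).
    by rewrite ac; congr (_, _); rewrite /= ?mulrNN -expr2 [RHS]mulr1.
  apply/vlineP=> -[d [cd cNd]]; move/eqP: (two_neq0 F_char); apply.
  have c0 : c != 0 by apply: contraNneq a0 => c0; rewrite ac c0 expr0n.
  apply: (mulfI c0); rewrite mulr0 mulr_natr mulr2n {2}cd -cNd.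
  exact: subrr.
have p_irr : irreducible_poly ('X^2 - a%:P).
  apply: cubic_irreducible => [|x]; first by rewrite size_XnsubC.
  apply/negP; rewrite /root !hornerE subr_eq0 => /eqP xa.
  by apply: a_nsq; exists x; rewrite xa.
have [L dL [z z_root _]] := irredp_FAdjoin p_irr.
have dimL : \dim {:L} = 2%N by rewrite dL size_XnsubC.
exists L; split=> //; first exact: Quadratic_factor.
have zz : z * z = a%:A.
  move: z_root; rewrite /root rmorphB /= map_polyXn map_polyC /= !hornerE.
  by rewrite subr_eq0 expr2 => /eqP.
exists z => //; apply/vlineP=> -[d zd]; apply: a_nsq; exists d.
move: zz; rewrite zd -scalerAl mul1r scalerA => /eqP.
rewrite -subr_eq0 -scalerBl scaler_eq0 oner_eq0 orbF subr_eq0 => /eqP <-.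
by rewrite expr2.
Qed.

Lemma quaternion_factor (al be : F) (v w : C) :
    al != 0 -> be != 0 -> v * v = al%:A -> w * w = be%:A -> v * w + w * v = 0 ->
  exists Q : falgType F, [/\ C_factor Q, \dim {:Q} = 4%N
    & exists2 k : {lrmorphism Q -> C},
        (exists x, k x = v) /\ (exists x, k x = w)
        & forall y, exists p q r s,
            k y = p *: 1 + q *: v + r *: w + s *: (v * w)].
Proof.
move=> al0 be0 vv ww vw; have [k [kv kw] _] := quat_universal vv ww vw.
have kE y : exists p q r s, k y = p *: 1 + q *: v + r *: w + s *: (v * w).
  exists (y (false, false)), (y (true, false)).
  exists (y (false, true)), (y (true, true)).
  by rewrite {1}[y]quat_sum !linearD !linearZ rmorph1 rmorphM /= kv kw.
have [[ga [de norm_be]]|not_norm] :=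
  classic (exists ga de : F, be + de ^+ 2 * al = ga ^+ 2).
  have [e /lrmorphism_inv[e' eK e'K]] := quat_split F_char al0 be0 norm_be.
  exists 'M[F]_2; split; [exact: Matrix_factor | by rewrite dimvf | ].
  have [||x y|h hE] := @lrmorphism_of_fun _ _ _ (k \o e').
  - exact: linearP.
  - by rewrite /= !rmorph1.
  - by rewrite /= !rmorphM.
  exists h => [|y]; last by rewrite hE; apply: kE.
  by split; [exists (e (quat_i al be)) | exists (e (quat_j al be))];
     rewrite hE /= eK.
exists (quat al be); split; last 1 first.
- by exists k => //; split; [exists (quat_i al be) | exists (quat_j al be)].
- by apply: Quaternion_factor => //; apply: (quat_division F_char).
- exact: dim_quat.
Qed.

End Factors.

(** * Commutation in C(V, g, lam) *)

Section Generation.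
Variables (F : fieldType) (V : vectType 'F_2) (n : nat) (b : n.-tuple V).
Variables (g : {biscalar V}) (lam : 'I_n -> F).
Hypothesis F_char : 2%N \notin [pchar F].
Hypothesis lam_neq0 : forall i, lam i != 0.
Local Notation C := (Calg b g lam).
Local Notation E := (Cbasis b g lam).
Implicit Types (U W : {vspace V}) (u v w : V).

Definition polar v w : 'F_2 := g v w + g w v.

Lemma sgn2_neq0 (e : 'F_2) : sgn2 F e != 0.
Proof. by rewrite /sgn2 expf_neq0 // oppr_eq0 oner_eq0. Qed.

Lemma CbasisM_coef_neq0 v w : sgn2 F (g v w) * Lam b g lam v w != 0.
Proof.
rewrite mulf_neq0 ?sgn2_neq0 //; apply/prodf_neq0 => i _.
by rewrite mulf_neq0 ?sgn2_neq0.
Qed.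

Lemma addvv2 v : v + v = 0.
Proof.
by rewrite -mulr2n -scaler_nat (_ : 2%:R = 0) ?scale0r //; apply/val_inj.
Qed.

Lemma Cbasis_sqr v : exists2 a : F, a != 0 & E v * E v = a%:A.
Proof.
exists (sgn2 F (g v v) * Lam b g lam v v); first exact: CbasisM_coef_neq0.
by rewrite CbasisM addvv2.
Qed.

(** The factor Lam is symmetric, so that only the signs given by g matter. *)
Lemma CbasisC v w : E v * E w = sgn2 F (polar v w) *: (E w * E v).
Proof.
rewrite !CbasisM scalerA addrC /polar sgn2D.
have -> : Lam b g lam v w = Lam b g lam w v.
  by apply: eq_bigl => i; rewrite mulrC.
congr (_ *: _); rewrite -!mulrA; congr (_ * _); rewrite mulrA -sgn2D.
suff -> : g w v + g w v = 0 by rewrite /sgn2 expr0 mul1r.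
by case: (F2P (g w v)) => ->; apply/val_inj.
Qed.

Lemma Cbasis_comm v w : polar v w = 0 -> E v * E w = E w * E v.
Proof. by rewrite CbasisC => ->; rewrite /sgn2 expr0 scale1r. Qed.

Lemma Cbasis_anticomm v w : polar v w = 1 -> E v * E w + E w * E v = 0.
Proof. by rewrite CbasisC => ->; rewrite /sgn2 expr1 scaleN1r addNr. Qed.

Lemma polarC v w : polar v w = polar w v. Proof. exact: addrC. Qed.

Lemma polarvv v : polar v v = 0.
Proof. by rewrite /polar; case: (F2P (g v v)) => ->; apply/val_inj. Qed.

Lemma polarDl u v w : polar (u + v) w = polar u w + polar v w.
Proof. by rewrite /polar linearDl linearDr addrACA. Qed.

Lemma polarZl e u w : polar (e *: u) w = e * polar u w.
Proof.
case: (F2P e) => ->; rewrite ?scale0r ?scale1r ?mul1r // mul0r.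
by rewrite /polar linear0l linear0r addr0.
Qed.

(** * Subspaces generated by an algebra *)

(** The second condition says that the image of A lies in the bicommutant of the
    basis vectors from U. It is what makes the images for two orthogonal
    subspaces commute, and unlike an explicit description of the image it passes
    to sums of subspaces without computation. *)
Definition generates (A : falgType F) U : Prop :=
  exists phi : {lrmorphism A -> C},
  [/\ forall u, u \in U -> exists x, phi x = E u,
      forall z, (forall u, u \in U -> E u * z = z * E u) ->
        forall x, phi x * z = z * phi x
    & \dim {:A} = (2 ^ \dim U)%N].

Lemma generates0 : generates (F^o : falgType F) 0%VS.
Proof.
have [||x y|k kE] := @lrmorphism_of_fun F (F^o : falgType F) C (in_alg C).
- by move=> c x y; rewrite /= scalerDl scalerA.
- by rewrite /= scale1r.
- by rewrite /= -scalerAl mul1r scalerA.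
exists k; split=> [u|z _ x|]; last by rewrite dimvf dimv0.
  by rewrite memv0 => /eqP->; exists 1; rewrite kE /= scale1r.
by rewrite kE /= mulr_algl mulr_algr.
Qed.

(** As E u * E w is a nonzero multiple of E (u + w), the pure tensors reach the
    basis vectors of U + W. *)
Lemma generates_tensor (A B : falgType F) U W :
    generates A U -> generates B W -> (U :&: W = 0)%VS ->
    (forall u w, u \in U -> w \in W -> polar u w = 0) ->
  generates (tensor A B) (U + W).
Proof.
move=> [f [fU fC dA]] [h [hW hC dB]] UW0 UW.
have fhC x y : f x * h y = h y * f x.
  apply: fC => u Uu; apply/esym/hC => w Ww.
  by apply/esym/Cbasis_comm/UW.
have [k kE] := tensor_hom fhC; exists k; split=> [x|z zC x|].
- case/memv_addP=> u Uu [w Ww ->].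
  have [[xu fxu] [xw hxw]] := (fU u Uu, hW w Ww).
  exists ((sgn2 F (g u w) * Lam b g lam u w)^-1 *: pure xu xw).
  rewrite linearZ /= kE fxu hxw CbasisM scalerA mulVf ?scale1r //.
  exact: CbasisM_coef_neq0.
- have fz y : f y * z = z * f y.
    by apply: fC => u Uu; apply: zC; apply: subvP (addvSl _ _) _ Uu.
  have hz y : h y * z = z * h y.
    by apply: hC => w Ww; apply: zC; apply: subvP (addvSr _ _) _ Ww.
  elim/tensor_ind: x => [|x y IHx IHy|y t].
  + by rewrite linear0 mul0r mulr0.
  + by rewrite linearD mulrDl mulrDr IHx IHy.
  by rewrite kE -mulrA hz !mulrA fz.
by rewrite dim_tensor dA dB dimv_disjoint_sum // expnD.
Qed.

Lemma generates_line v : v != 0 ->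
  exists2 A : falgType F, C_factor A & generates A <[v]>.
Proof.
move=> v0; have [a a0 vv] := Cbasis_sqr v.
have [A [AF dA [k [z kz] kE]]] := quadratic_factor F_char a0 vv.
exists A => //; exists k; split=> [u|y yC x|].
- case/vlineP=> e ->; case: (F2P e) => ->.
    by rewrite scale0r; exists 1; rewrite rmorph1.
  by rewrite scale1r; exists z.
- have [p [q ->]] := kE x.
  have vy := yC v (memv_line v).
  by rewrite mulrDl mulrDr -!scalerAl -!scalerAr mul1r mulr1 vy.
by rewrite dA dim_vline v0.
Qed.

(** polar is alternating, hence vanishes on linearly dependent pairs. *)
Lemma polar1_free v w : polar v w = 1 -> v != 0 /\ w \notin <[v]>%VS.
Proof.
move=> vw; split.
  by apply: contra_eqN vw => /eqP->; rewrite /polar linear0l linear0r addr0.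
apply/vlineP=> -[e we]; move: vw; rewrite we.
case: (F2P e) => ->; rewrite ?scale0r ?scale1r ?polarvv //.
by rewrite /polar linear0l linear0r addr0.
Qed.

Lemma generates_plane v w : polar v w = 1 ->
  exists2 A : falgType F, C_factor A & generates A (<[v]> + <[w]>).
Proof.
move=> vw; have [v0 wv] := polar1_free vw.
have [al al0 vv] := Cbasis_sqr v; have [be be0 ww] := Cbasis_sqr w.
have [A [AF dA [k [[x kx] [y ky]] kE]]] :=
  quaternion_factor F_char al0 be0 vv ww (Cbasis_anticomm vw).
exists A => //; exists k; split=> [u|t tC x'|].
- case/memv_addP=> _ /vlineP[e ->] [_ /vlineP[e' ->] ->].
  case: (F2P e) => ->; case: (F2P e') => ->;
    rewrite ?scale0r ?scale1r ?addr0 ?add0r.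
  + by exists 1; rewrite rmorph1.
  + by exists y.
  + by exists x.
  exists ((sgn2 F (g v w) * Lam b g lam v w)^-1 *: (x * y)).
  rewrite linearZ rmorphM /= kx ky CbasisM scalerA mulVf ?scale1r //.
  exact: CbasisM_coef_neq0.
- have [p [q [r [s ->]]]] := kE x'.
  have vt : E v * t = t * E v.
    by apply: tC; apply: subvP (addvSl _ _) _ (memv_line v).
  have wt : E w * t = t * E w.
    by apply: tC; apply: subvP (addvSr _ _) _ (memv_line w).
  rewrite !mulrDl !mulrDr -!scalerAl -!scalerAr mul1r mulr1 vt wt.
  by rewrite -mulrA wt !mulrA vt.
have vw0 : (<[v]> :&: <[w]> = 0)%VS.
  apply/eqP; rewrite -subv0; apply/subvP=> u; rewrite memv_cap => /andP[].
  case/vlineP=> e -> /vlineP[e'].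
  case: (F2P e) => ->; rewrite ?scale0r ?mem0v //.
  case: (F2P e') => ->; rewrite !scale1r ?scale0r => vE.
    by rewrite vE eqxx in v0.
  by rewrite vE memv_line in wv.
rewrite dA dimv_disjoint_sum // !dim_vline v0.
by case: eqP wv => // ->; rewrite mem0v.
Qed.

(** * Orthogonal decomposition of V *)

Lemma orthogonal_vspace w :
  exists P : {vspace V}, forall u, (u \in P) = (polar u w == 0).
Proof.
pose f : V -> ('F_2)^o := polar^~ w.
have f_lin : linear f by move=> c x y; rewrite /f polarDl polarZl.
pose fL : {linear V -> ('F_2)^o} :=
  HB.pack f (GRing.isLinear.Build _ _ _ _ f f_lin).
by exists (lker (linfun fL)) => u; rewrite memv_ker lfunE.
Qed.

(** W is the orthogonal of v and w in U: over F_2, the component of u in the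
    plane is polar u w *: v + polar u v *: w. *)
Lemma hyperbolic_split v w U : polar v w = 1 -> v \in U -> w \in U ->
  exists W, [/\ U = (<[v]> + <[w]> + W)%VS, ((<[v]> + <[w]>) :&: W = 0)%VS
    & forall u x, u \in (<[v]> + <[w]>)%VS -> x \in W -> polar u x = 0].
Proof.
move=> vw Uv Uw; have wv : polar w v = 1 by rewrite polarC.
have [Pv PvE] := orthogonal_vspace v; have [Pw PwE] := orthogonal_vspace w.
exists (U :&: Pv :&: Pw)%VS.
have orth u x : u \in (<[v]> + <[w]>)%VS ->
    x \in (U :&: Pv :&: Pw)%VS -> polar u x = 0.
  case/memv_addP=> _ /vlineP[e ->] [_ /vlineP[e' ->] ->].
  rewrite !memv_cap PvE PwE => /andP[/andP[_ /eqP xv] /eqP xw].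
  by rewrite polarDl !polarZl !(polarC _ x) xv xw !mulr0 addr0.
split=> //.
  apply/eqP; rewrite eqEsubv !subv_add -!memvE Uv Uw /=.
  rewrite -capvA capvSl andbT; apply/subvP=> u Uu.
  pose p := polar u w *: v + polar u v *: w.
  have pP : p \in (<[v]> + <[w]>)%VS by rewrite memv_add ?memvZ ?memv_line.
  rewrite -(subrKC p u) memv_add // !memv_cap PvE PwE.
  have Up : p \in U by rewrite memvD ?memvZ.
  rewrite memvB //= -scaleN1r !polarDl !polarZl /p !polarDl !polarZl.
  by rewrite !polarvv vw wv !mulr0 !mulr1 add0r addr0 !mulN1r !subrr eqxx.
apply/eqP; rewrite -subv0; apply/subvP=> u; rewrite memv_cap => /andP[uP uW].
rewrite memv0; case/memv_addP: (uP) uW => _ /vlineP[e ->] [_ /vlineP[e' ->] ->].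
rewrite !memv_cap PvE PwE !polarDl !polarZl !polarvv vw wv.
rewrite !mulr0 !mulr1 add0r addr0 => /andP[/andP[_ /eqP->] /eqP->].
by rewrite !scale0r addr0.
Qed.

(** Each step splits off from U a line, if the vector picked is orthogonal to U,
    or else a hyperbolic plane. In the first case any complement of the line
    will do. *)
Lemma generates_all U : exists s : seq (falgType F),
  List.Forall (@C_factor F) s /\ generates (tensor_all s) U.
Proof.
have [d] := ubnP (\dim U); elim: d U => // d IH U; rewrite ltnS => dU.
have [U0|U0] := eqVneq U 0%VS.
  by rewrite U0; exists [::]; split; [constructor | apply: generates0].
have step (P W : {vspace V}) :
    (exists2 A : falgType F, C_factor A & generates A P) ->
    P != 0%VS -> U = (P + W)%VS -> (P :&: W = 0)%VS ->
    (forall u w, u \in P -> w \in W -> polar u w = 0) ->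
  exists s : seq (falgType F),
    List.Forall (@C_factor F) s /\ generates (tensor_all s) U.
  move=> [A AF AP] P0 UE PW0 PW.
  have [|s [sF sW]] := IH W.
    apply: leq_trans dU; rewrite UE dimv_disjoint_sum //.
    by rewrite -[X in (X < _)%N]add0n ltn_add2r lt0n dimv_eq0.
  exists (A :: s); split; first by constructor.
  by rewrite UE; apply: generates_tensor.
have Uv := memv_pick U; have v0 : vpick U != 0 by rewrite vpick0.
move: (vpick U) Uv v0 => v Uv v0.
have [Pv PvE] := orthogonal_vspace v.
have [|] := boolP (U <= Pv)%VS.
  move/subvP=> Uperp; apply: (step <[v]>%VS (U :\: <[v]>)%VS).
  - exact: generates_line.
  - by rewrite -dimv_eq0 dim_vline v0.
  - by rewrite addvC addv_diff; apply/esym/addv_idPl; rewrite -memvE.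
  - by rewrite capvC capv_diff.
  move=> _ x /vlineP[e ->] /(subvP (diffvSl _ _)) /Uperp.
  by rewrite PvE polarZl polarC => /eqP->; rewrite mulr0.
case/subvPn=> w Uw; rewrite PvE => wv.
have vw : polar v w = 1.
  by rewrite polarC; case: (F2P (polar w v)) wv => -> //; rewrite eqxx.
have [W [UE PW0 PW]] := hyperbolic_split vw Uv Uw.
apply: (step (<[v]> + <[w]>)%VS W) => //; first exact: generates_plane.
rewrite -dimv_eq0 -lt0n; apply: leq_trans (dimvS (addvSl _ _)).
by rewrite dim_vline v0.
Qed.

(** The image contains the basis vectors, hence everything, and both sides have
    dimension #|V| = 2^(dim V). *)
Lemma generates_full_iso (A : falgType F) : generates A fullv -> alg_iso C A.
Proof.
move=> [phi [phiE _ dA]].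
have [|psi psiK phiK] := @lrmorphism_inv F A C phi; last first.
  by exists psi, phi.
apply: onto_bijective => [|y].
  rewrite dA [in RHS]dimvf [RHS]dim_ffun_scalar dimvf.
  transitivity #|{: finvect_type V}%VS|; last first.
    by apply: eq_card => v; rewrite memvf.
  by rewrite card_vspace dimvf card_Fp.
rewrite [y]Cbasis_sum; elim/big_ind: _ => [|y1 y2 [x1 <-] [x2 <-]|v _].
- by exists 0; rewrite linear0.
- by exists (x1 + x2); rewrite linearD.
have [x xE] := phiE v (memvf v).
by exists (y v *: x); rewrite linearZ /= xE.
Qed.

End Generation.

Theorem theorem5p2 (F : fieldType) (F_char : 2%N \notin [pchar F])
    (V : vectType 'F_2) (n : nat) (b : n.-tuple V) (b_basis : basis_of {:V} b)
    (g : {biscalar V}) (lam : 'I_n -> F) (lam_neq0 : forall i, lam i != 0) :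
  exists s : seq (falgType F),
    List.Forall (@C_factor F) s /\ alg_iso (Calg b g lam) (tensor_all s).
Proof.
have [s [sF sV]] := generates_all b g F_char lam_neq0 fullv.
by exists s; split=> //; apply: generates_full_iso.
Qed.
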